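(* Assume that $F$ is $\mu$-strongly convex and $\eta$-smooth with $0<\mu<\eta$, that every consensus matrix satisfies the conditions listed in the context, and that the step size is $\beta=1/\eta$. Let $\kappa\ge1$ be an integer and let $$\epsilon\in\Big[\big(1-\tfrac{\mu}{\eta}\big)^{\kappa}\big(F(\mathbf w^{(0)})-F(\mathbf w^* )\big),\ F(\mathbf w^{(0)})-F(\mathbf w^* )\Big).$$ Put $\Phi=N_{J-1}+\cdots+N_1+N_0$ (with $N_0=1$). Then, for every realization of MH-FL, each of the following two conditions is sufficient for $F(\mathbf w^{(\kappa)})-F(\mathbf w^* )\le\epsilon$: 1. There are non-negative constants $\sigma_1,\dots,\sigma_J$ with $$\sum_{j=0}^{J-1}\sigma_{j+1}N_j\ \le\ \frac{\epsilon-(1-\mu/\eta)^{\kappa}\big(F(\mathbf w^{(0)})-F(\mathbf w^* )\big)}{\big(1-(1-\mu/\eta)^{\kappa}\big)\frac{\eta^2\Phi}{2\mu D^2}}$$ such that for all $k\ge1$, with $\sigma_j^{(k)}:=\sigma_j$, the round criterion $R(\sigma_1^{(k)},\dots,\sigma_J^{(k)};k)$ of the context holds. 2. There are $\delta$ with $0<\delta\le\mu/\eta$ and $$\delta\ \ge\ 1-\sqrt[\kappa]{\frac{\epsilon}{F(\mathbf w^{(0)})-F(\mathbf w^* )}}$$ and, for all $k\ge1$, non-negative constants $\sigma_1^{(k)},\dots,\sigma_J^{(k)}$ with $$\sum_{j=0}^{J-1}\sigma^{(k)}_{j+1}N_j\le\frac{D^2\mu(\mu-\delta\eta)}{\eta^4\Phi}\big\|\nabla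 F(\mathbf w^{(k-1)})\big\|^2$$ such that the round criterion $R(\sigma_1^{(k)},\dots,\sigma_J^{(k)};k)$ holds.
   Context: **Network.** Fix an integer $J\ge 1$ (the number of layers below the server). For $0\le j\le J$ let $\mathcal N_j$ be a finite nonempty set (the nodes of layer $j$), $N_j=|\mathcal N_j|$; $\mathcal N_0=\{0\}$ is the main server, so $N_0=1$; $\mathcal N_J$ are the end devices. At each global iteration $k\ge1$, each node $n\in\mathcal N_j$, $0\le j\le J-1$, has a nonempty set of children $\mathcal Q^{(k)}(n)\subseteq\mathcal N_{j+1}$, and the sets $\mathcal Q^{(k)}(n)$, $n\in\mathcal N_j$, partition $\mathcal N_{j+1}$ (they may change with $k$). The cluster below $n$ is denoted $Q(n)$; its node set at iteration $k$ is $\mathcal Q^{(k)}(n)$. Thus clusters of layer $j+1$ are in bijection with nodes of layer $j$. At iteration $k$ each cluster $C$ operates either in LUT mode or in EUT mode. **Loss.** Each end device $n\in\mathcal N_J$ has a finite nonempty dataset $\mathcal D_n$ and a differentiable local loss $f_n:\mathbb R^M\to\mathbb R$. Put $D=\sum_{n\in\mathcal N_J}|\mathcal D_n|$, $F(\mathbf w)=\frac1D\sum_{n\in\mathcal N_J}|\mathcal D_n|f_n(\mathbf w)$, and $\mathbf w^*=\arg\min_{\mathbf w\in\mathbb R^M}F(\mathbf w)$. $\mu$-strong convexity: $F(\mathbf y)\ge F(\mathbf x)+(\mathbf y-\mathbf x)^\top\nabla F(\mathbf x)+\frac\mu2\|\mathbf y-\mathbf x\|^2$ for all $\mathbf x,\mathbf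 y$; $\eta$-smoothness: $\|\nabla F(\mathbf x)-\nabla F(\mathbf y)\|\le\eta\|\mathbf x-\mathbf y\|$ for all $\mathbf x,\mathbf y$. $\|\cdot\|$ is the Euclidean norm. **Consensus matrices.** For a cluster $C$ with node set $\mathcal C^{(k)}$ that is LUT at iteration $k$, there is a connected undirected graph $G_C^{(k)}$ on $\mathcal C^{(k)}$, a number of device-to-device (D2D) rounds $\theta^{(k)}_C\in\{0,1,2,\dots\}$, and a real matrix $\mathbf V^{(k)}_C$ indexed by $\mathcal C^{(k)}$ with: (i) $(\mathbf V_C^{(k)})_{m,n}=0$ if $m\ne n$ are not adjacent in $G_C^{(k)}$; (ii) $\mathbf V_C^{(k)}\mathbf 1=\mathbf 1$; (iii) $\mathbf V_C^{(k)}$ is symmetric; (iv) the spectral radius satisfies $\rho\big(\mathbf V_C^{(k)}-\mathbf 1\mathbf 1^\top/|\mathcal C^{(k)}|\big)\le\lambda^{(k)}_C$ for a given number $0<\lambda_C^{(k)}<1$. **MH-FL.** Start from $\mathbf w^{(0)}\in\mathbb R^M$. At iteration $k\ge1$, each end device $n\in\mathcal N_J$ computes $\mathbf w_n^{(k)}=\mathbf w^{(k-1)}-\beta\nabla f_n(\mathbf w^{(k-1)})$ and sets its scaled parameter $\widetilde{\mathbf w}^{(k)}_n=|\mathcal D_n|\mathbf w^{(k)}_n$. Then for $j=J-1,J-2,\dots,0$ each node $n\in\mathcal N_j$ with child cluster $C=Q(n)$ obtains $\widetilde{\mathbf w}_n^{(k)}$ as follows. If $C$ is EUT: $\widetilde{\mathbf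 w}_n^{(k)}=\sum_{i\in\mathcal Q^{(k)}(n)}\widetilde{\mathbf w}^{(k)}_i$. If $C$ is LUT: let $\widetilde{\mathbf W}_C^{(k)}$ be the matrix whose rows are $\widetilde{\mathbf w}_i^{(k)}$, $i\in\mathcal Q^{(k)}(n)$, let $\widehat{\mathbf W}_C^{(k)}=(\mathbf V_C^{(k)})^{\theta_C^{(k)}}\widetilde{\mathbf W}_C^{(k)}$ with rows $\widehat{\mathbf w}_i^{(k)}$; the parent samples one (arbitrary) child $n'\in\mathcal Q^{(k)}(n)$ and sets $\widetilde{\mathbf w}_n^{(k)}=|\mathcal Q^{(k)}(n)|\,\widehat{\mathbf w}_{n'}^{(k)}$. Finally the server sets $\mathbf w^{(k)}=\widetilde{\mathbf w}_0^{(k)}/D$. A realization is any choice of the sampled children. **Divergence.** For each cluster $C$ and iteration $k$, $\Upsilon_C^{(k)}$ is a number with $\|\widetilde{\mathbf w}_q^{(k)}-\widetilde{\mathbf w}_{q'}^{(k)}\|\le\Upsilon_C^{(k)}$ for all $q,q'\in\mathcal C^{(k)}$. **Round criterion $R(s_1,\dots,s_J;k)$** (for $s_j\ge0$): for every layer $1\le j\le J$ and every cluster $C$ of layer $j$ that is LUT at iteration $k$, $$\theta_C^{(k)}\ge\left\lceil\frac{\log(s_j)-2\log\big(|\mathcal C^{(k)}|^{3/2}\Upsilon_C^{(k)}\big)}{2\log\big(\lambda_C^{(k)}\big)}\right\rceil\ \text{ if } s_j\le|\mathcal C^{(k)}|^3(\Upsilon_C^{(k)})^2,$$ and $\theta_C^{(k)}\ge0$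 otherwise. Convention: $\log0=-\infty$; if $s_j=0<\Upsilon_C^{(k)}$ the lower bound is $+\infty$ (not satisfiable by a finite number of rounds); if $s_j=0=\Upsilon_C^{(k)}$ the condition is read as $\theta_C^{(k)}\ge0$. *)

(* Defs.v *)
From HB Require Import structures.
From mathcomp Require Import all_boot all_order all_algebra.
From mathcomp Require Import complex.
From mathcomp Require Import all_classical all_reals all_analysis.

Set Implicit Arguments.
Unset Strict Implicit.
Unset Printing Implicit Defensive.

Import Order.TTheory GRing.Theory Num.Theory.
Import numFieldNormedType.Exports.

Local Open Scope classical_set_scope.
Local Open Scope ring_scope.

(* The library norm [`|v|] on row vectors is the sup norm, hence [enorm].    *)
Definition dot (R : realType) (M : nat) (u v : 'rV[R]_M) : R :=
  (u *m v^T) 0 0.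

Definition enorm (R : realType) (M : nat) (v : 'rV[R]_M) : R :=
  Num.sqrt (dot v v).

Definition grad (R : realType) (M : nat) (f : 'rV[R]_M -> R) (x : 'rV[R]_M) :
  'rV[R]_M := \row_i ('D_(delta_mx 0 i) f x : R).

Definition strongly_convex (R : realType) (M : nat) (mu : R)
    (F : 'rV[R]_M -> R) : Prop :=
  forall x y, F y >= F x + dot (y - x) (grad F x) + mu / 2 * enorm (y - x) ^+ 2.

Definition smooth (R : realType) (M : nat) (eta : R)
    (F : 'rV[R]_M -> R) : Prop :=
  forall x y, enorm (grad F x - grad F y) <= eta * enorm (x - y).

(* Largest modulus of a complex eigenvalue. For matrices of size 0 it is     *)
(* [sup set0 = 0], a case that never occurs below.                           *)
Definition spectral_radius (R : realType) (c : nat) (A : 'M[R]_c) : R :=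
  sup [set ComplexField.Normc.normc z |
       z in [set z : R[i] | eigenvalue (map_mx (real_complex R) A) z]].

Definition connected_graph (T : finType) (G : rel T) : Prop :=
  [/\ symmetric G, irreflexive G & forall x y, connect G x y].

Definition consensus_matrix (R : realType) (c : nat) (G : rel 'I_c)
    (lambda : R) (V : 'M[R]_c) : Prop :=
  [/\ forall a b, a != b -> ~~ G a b -> V a b = 0,
      V *m const_mx 1 = const_mx 1 :> 'cV[R]_c,
      V^T = V
    & spectral_radius (V - const_mx (c%:R^-1)) <= lambda].

(* [node j] is the set of nodes of layer [j] (only [j <= J] is relevant), and *)
(* [Q k n] the set of children of [n] at iteration [k >= 1]. A cluster of     *)
(* layer [j.+1] is identified with its parent [n : node j].                   *)
Definition is_network (J : nat) (node : nat -> finType)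
    (Q : forall (k j : nat), node j -> {set node j.+1}) : Prop :=
  [/\ forall j, (j <= J)%N -> (0 < #|node j|)%N,
      #|node 0%N| = 1%N
    & forall k j, (1 <= k)%N -> (j < J)%N ->
      [/\ forall n, Q k j n != finset.set0,
          forall n n', n != n' -> (Q k j n :&: Q k j n' = finset.set0)%SET
        & (\bigcup_(n : node j) Q k j n = finset.setT)%SET]].

Definition total_data (T : finType) (data : T -> finType) : nat :=
  (\sum_(n : T) #|data n|)%N.

Definition global_loss (R : realType) (M : nat) (T : finType)
    (data : T -> finType) (f : T -> 'rV[R]_M -> R) (w : 'rV[R]_M) : R :=
  1 / (total_data data)%:R * \sum_(n : T) #|data n|%:R * f n w.

(* The members of a cluster [C] are numbered by ['I_#|C|] through [enum_val]; *)
(* consensus matrices, D2D graphs and sampled children use this numbering.    *)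
Definition cluster_mx (R : realType) (M : nat) (T : finType) (C : {set T})
    (v : T -> 'rV[R]_M) : 'M[R]_(#|C|, M) :=
  \matrix_(a < #|C|) v (enum_val a).

(* [w k] is the global parameter, [wt k n] the scaled parameter of node [n],  *)
(* and [lut k n] tells whether the cluster below [n] is LUT (otherwise EUT).  *)
(* The sampled children [a] are arbitrary at each LUT cluster and iteration,  *)
(* so that the pairs [(w, wt)] in this relation are exactly the realizations. *)
Definition mhfl_run (R : realType) (M J : nat) (node : nat -> finType)
    (server : node 0%N)
    (Q : forall (k j : nat), node j -> {set node j.+1})
    (data : node J -> finType) (f : node J -> 'rV[R]_M -> R) (beta : R)
    (lut : forall (k j : nat), node j -> bool)
    (V : forall (k j : nat) (n : node j), 'M[R]_#|Q k j n|)
    (theta : forall (k j : nat), node j -> nat)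
    (w0 : 'rV[R]_M) (w : nat -> 'rV[R]_M)
    (wt : forall (k j : nat), node j -> 'rV[R]_M) : Prop :=
  w 0%N = w0 /\
  forall k, (1 <= k)%N ->
  [/\ forall n : node J,
        wt k J n =
          #|data n|%:R *: (w k.-1 - beta *: grad (f n) (w k.-1)),
      forall j (n : node j), (j < J)%N -> ~~ lut k j n ->
        wt k j n = \sum_(i in Q k j n) wt k j.+1 i,
      forall j (n : node j), (j < J)%N -> lut k j n ->
        exists a : 'I_#|Q k j n|,
          wt k j n = #|Q k j n|%:R *:
            row a (V k j n ^+ theta k j n *m cluster_mx (Q k j n) (wt k j.+1))
    & w k = (total_data data)%:R^-1 *: wt k 0%N server].

(* Lower bound on the number of D2D rounds in a cluster of size [c], with     *)
(* [log 0 = -oo]. The library's [ln 0] is [0], so [s = 0] is separated: the   *)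
(* bound is then [+oo] (unsatisfiable) if [0 < upsilon], void if              *)
(* [upsilon = 0]. If [0 < s], the premise forces [upsilon != 0].              *)
Definition enough_rounds (R : realType) (s upsilon lambda : R)
    (c theta : nat) : Prop :=
  s <= c%:R ^+ 3 * upsilon ^+ 2 ->
  if s == 0 then upsilon = 0
  else Num.ceil ((ln s - 2 * ln (c%:R `^ (3 / 2) * upsilon))
                 / (2 * ln lambda)) <= theta%:Z.

Definition round_criterion (R : realType) (J : nat) (node : nat -> finType)
    (Q : forall (k j : nat), node j -> {set node j.+1})
    (lut : forall (k j : nat), node j -> bool)
    (theta : forall (k j : nat), node j -> nat)
    (lambda upsilon : forall (k j : nat), node j -> R)
    (s : nat -> R) (k : nat) : Prop :=
  forall j (n : node j), (j < J)%N -> lut k j n ->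
    enough_rounds (s j.+1) (upsilon k j n) (lambda k j n)
                  #|Q k j n| (theta k j n).

(* Main.v *)
(* Gradients of the global loss enter the aggregated parameter exactly; all   *)
(* the rest is an error [e], a sum over the LUT clusters of the difference    *)
(* between [c] times the sampled consensus value and the true sum of the [c]  *)
(* children. Since a consensus matrix is symmetric and fixes constants, this  *)
(* difference is governed by [(V - 1 1^T / c) ^ theta], whose operator norm   *)
(* is at most [lambda ^ theta] by the spectral theorem; the round criterion   *)
(* says precisely that its square is at most [sigma]. Hence, with [S] the     *)
(* layered sum of the [sigma]s, Cauchy-Schwarz gives [D^2 |e|^2 <= Phi S],    *)
(* and one perturbed gradient step yields                                     *)
(*   F(w_k) <= F(w_(k-1)) - |grad F|^2 / (2 eta) + eta Phi S / (2 D^2).       *)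
(* The Polyak-Lojasiewicz inequality turns this into an affine recursion of   *)
(* ratio [1 - mu / eta] (condition 1) or, when [S] is at most a multiple of   *)
(* [|grad F|^2], into a contraction of ratio [1 - delta] (condition 2).       *)

Require Import Defs.
From HB Require Import structures.
From mathcomp Require Import all_boot all_order all_algebra.
From mathcomp Require Import complex.
From mathcomp Require Import all_classical all_reals all_analysis.
From mathcomp Require Import ring lra.

Set Implicit Arguments.
Unset Strict Implicit.
Unset Printing Implicit Defensive.

Import Order.TTheory GRing.Theory Num.Theory.
Import numFieldNormedType.Exports.

Local Open Scope ring_scope.

(** The server's aggregate is an exact gradient step plus an error. Children partition every layer,
    so layer sums telescope ([sum_layers]), and the error is the sum over all clusters of a local
    discrepancy: what the parent obtains minus the true sum of its children. It vanishes for EUT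
    clusters. For an LUT cluster of size [c] its square is at most [c ^+ 3 * lambda ^+ (2 * theta) *
    upsilon ^+ 2] ([consensus_error]), and the round criterion is the logarithm of the statement
    that this is at most sigma ([enough_rounds_bound]). [mhfl_iteration_error] collects the
    clusters, Phi in number.

    With step size [1 / eta] the inner product of gradient and error cancels in the descent
    inequality ([perturbed_step]), so the error enters only through its square. By
    [strongly_convex_polyak_lojasiewicz] the gradient term dominates the optimality gap. Under
    condition 1 the constant errors add up to a geometric series ([affine_recursion_le]) that fits
    the budget; under condition 2 the error consumes only part of the gradient decrease, and what
    remains contracts the gap by [1 - delta]. *)

Section EuclideanNorm.
Variable R : realType.
Implicit Types M : nat.

(** * Euclidean inner product and norm on row vectors *)

Lemma dotE M (u v : 'rV[R]_M) : dot u v = \sum_i u 0 i * v 0 i.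
Proof. by rewrite /dot mxE; apply: eq_bigr => i _; rewrite mxE. Qed.

Lemma dotC M (u v : 'rV[R]_M) : dot u v = dot v u.
Proof. by rewrite !dotE; apply: eq_bigr => i _; rewrite mulrC. Qed.

Lemma dotDl M (u v x : 'rV[R]_M) : dot (u + v) x = dot u x + dot v x.
Proof. by rewrite /dot mulmxDl mxE. Qed.

Lemma dotZl M a (u v : 'rV[R]_M) : dot (a *: u) v = a * dot u v.
Proof. by rewrite /dot -scalemxAl mxE. Qed.

Lemma dotNl M (u v : 'rV[R]_M) : dot (- u) v = - dot u v.
Proof. by rewrite -scaleN1r dotZl mulN1r. Qed.

Lemma dotDr M (u v x : 'rV[R]_M) : dot x (u + v) = dot x u + dot x v.
Proof. by rewrite dotC dotDl !(dotC x). Qed.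

Lemma dotZr M a (u v : 'rV[R]_M) : dot v (a *: u) = a * dot v u.
Proof. by rewrite dotC dotZl dotC. Qed.

Lemma dotNr M (u v : 'rV[R]_M) : dot v (- u) = - dot v u.
Proof. by rewrite dotC dotNl dotC. Qed.

Lemma dot0l M (v : 'rV[R]_M) : dot 0 v = 0.
Proof. by rewrite /dot mul0mx mxE. Qed.

Lemma dot_ge0 M (u : 'rV[R]_M) : 0 <= dot u u.
Proof. by rewrite dotE sumr_ge0 // => i _; rewrite -expr2 sqr_ge0. Qed.

Lemma enorm_ge0 M (u : 'rV[R]_M) : 0 <= enorm u.
Proof. exact: sqrtr_ge0. Qed.

Lemma sqr_enorm M (u : 'rV[R]_M) : enorm u ^+ 2 = dot u u.
Proof. by rewrite /enorm sqr_sqrtr ?dot_ge0. Qed.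

Lemma enormZ M a (u : 'rV[R]_M) : enorm (a *: u) = `|a| * enorm u.
Proof.
by rewrite /enorm dotZl dotZr mulrA -expr2 sqrtrM ?sqr_ge0// sqrtr_sqr.
Qed.

Lemma dot_le_enorm M (u v : 'rV[R]_M) : dot u v <= enorm u * enorm v.
Proof.
have [v0|v0] := eqVneq (dot v v) 0.
  have h t : 0 <= dot u u - t * 2 * dot u v.
    have := dot_ge0 (u - t *: v).
    rewrite dotDl !dotDr !dotNl !dotNr !dotZl !dotZr v0 (dotC v u); lra.
  rewrite {2}/enorm v0 sqrtr0 mulr0 leNgt; apply/negP => uv0.
  (* This value of [t] makes the right-hand side of [h] equal to -1. *)
  have := h ((dot u u + 1) / (2 * dot u v)).
  have -> : (dot u u + 1) / (2 * dot u v) * 2 * dot u v = dot u u + 1.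
    by field; rewrite gt_eqF.
  lra.
have vv : 0 < dot v v by rewrite lt_def v0 dot_ge0.
apply: ler_normlW; rewrite -(@ler_pXn2r _ 2)// ?nnegrE ?mulr_ge0 ?enorm_ge0//.
rewrite exprMn !sqr_enorm -normrX ger0_norm ?sqr_ge0//.
(* The squared norm of this vector is [dot v v] times the Cauchy-Schwarz defect. *)
have := dot_ge0 (dot v v *: u - dot u v *: v).
rewrite dotDl !dotDr !dotNl !dotNr !dotZl !dotZr (dotC v u) => h.
have : 0 <= dot v v * (dot u u * dot v v - dot u v ^+ 2) by lra.
by rewrite pmulr_rge0// subr_ge0.
Qed.

Lemma ler_enormD M (u v : 'rV[R]_M) : enorm (u + v) <= enorm u + enorm v.
Proof.
rewrite -(@ler_pXn2r _ 2)// ?nnegrE ?addr_ge0 ?enorm_ge0//.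
rewrite sqr_enorm dotDl !dotDr sqrrD !sqr_enorm (dotC v u).
have := dot_le_enorm u v; lra.
Qed.

Lemma enorm0 M : enorm (0 : 'rV[R]_M) = 0.
Proof. by rewrite /enorm dot0l sqrtr0. Qed.

Lemma ler_enorm_sum M (I : Type) (r : seq I) (P : pred I) (F : I -> 'rV[R]_M) :
  enorm (\sum_(i <- r | P i) F i) <= \sum_(i <- r | P i) enorm (F i).
Proof.
elim/big_ind2: _ => [|x a y b xa yb|//]; first by rewrite enorm0.
by rewrite (le_trans (ler_enormD _ _)) ?lerD.
Qed.

(** Lagrange's identity: the defect is half the double sum of the squares of [a i - a j]. *)
Lemma sqr_sum_le_card (I : finType) (a : I -> R) :
  (\sum_i a i) ^+ 2 <= #|I|%:R * \sum_i a i ^+ 2.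
Proof.
set S := \sum_i a i; set T := \sum_i a i ^+ 2.
have : 0 <= \sum_i \sum_j (a i - a j) ^+ 2.
  by do 2![apply: sumr_ge0 => ? _]; exact: sqr_ge0.
suff -> : \sum_i \sum_j (a i - a j) ^+ 2 = 2 * (#|I|%:R * T - S ^+ 2) by lra.
transitivity (\sum_i (#|I|%:R * a i ^+ 2 + (-2 * S) * a i + T)).
  apply: eq_bigr => i _.
  transitivity (\sum_j (a i ^+ 2 + (- 2 * a i) * a j + a j ^+ 2)).
    by apply: eq_bigr => j _; ring.
  rewrite !big_split/= sumr_const -mulr_sumr -[_ *+ #|_|]mulr_natl -/S -/T.
  by set n := #|_|%:R; ring.
rewrite !big_split/= sumr_const -!mulr_sumr -[_ *+ #|_|]mulr_natl -/S -/T.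
by set n := #|_|%:R; ring.
Qed.
End EuclideanNorm.

(** * Spectral radius and operator norm of a real symmetric matrix *)

Section SpectralBound.
Variable R : realType.

(** A supremum is an upper bound only for a bounded set. Eigenvalues are roots of the characteristic
    polynomial, so the sum of the moduli of all its roots bounds them. *)
Lemma normc_le_spectral_radius c (A : 'M[R]_c) (z : R[i]) :
  eigenvalue (map_mx (real_complex R) A) z ->
  ComplexField.Normc.normc z <= spectral_radius A.
Proof.
move=> Az; apply: ub_le_sup; last by exists z.
have [s sE] := closed_field_poly_normal (char_poly (map_mx (real_complex R) A)).
exists (\sum_(y <- s) ComplexField.Normc.normc y) => _ [y /= Ay <-].
have : root (char_poly (map_mx (real_complex R) A)) y.
  by rewrite -eigenvalue_root_char.
rewrite sE (monicP (char_poly_monic _)) scale1r root_prod_XsubC => ys.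
rewrite (big_rem y)//= lerDl sumr_ge0// => x _.
by case: x => ? ?; exact: sqrtr_ge0.
Qed.

(** Over the complex numbers [A] is normal, hence diagonal in a unitary basis. Unitary maps preserve
    the norm, and each diagonal entry, an eigenvalue, has modulus at most [lambda]. *)
Lemma symmetric_mulmx_bound c (A : 'M[R]_c) lambda (x : 'rV[R]_c) :
  A^T = A -> spectral_radius A <= lambda ->
  dot (x *m A) (x *m A) <= lambda ^+ 2 * dot x x.
Proof.
move=> symA rhoA; pose C := R[i].
pose toC m n : 'M[R]_(m, n) -> 'M[C]_(m, n) := map_mx (real_complex R).
pose nsq m (u : 'rV[C]_m) : C := (u *m map_mx Num.conj u^T) 0 0.
have nsqE m (u : 'rV[C]_m) : nsq m u = \sum_i `|u 0 i| ^+ 2.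
  by rewrite /nsq mxE; apply: eq_bigr => i _; rewrite !mxE normCK.
have conjR m n (B : 'M[R]_(m, n)) : map_mx Num.conj (toC _ _ B) = toC _ _ B.
  by apply/matrixP => i j; rewrite !mxE conj_Creal// complex_real.
have nsq_toC m (u : 'rV[R]_m) : nsq m (toC _ _ u) = (dot u u)%:C%C.
  by rewrite /nsq -map_trmx conjR map_trmx -map_mxM mxE.
set Ac := toC _ _ A.
have normalA : Ac \is normalmx.
  by apply/normalmxP; rewrite -map_trmx conjR map_trmx symA.
have /orthomx_spectralP := normalA.
have := spectral_unitarymx Ac; have := spectral_unit Ac.
set P := spectralmx Ac; set d := spectral_diag Ac => Pu PU AcE.
have nsqP (u : 'rV[C]_c) : nsq c (u *m P) = nsq c u.
  rewrite /nsq trmx_mul map_mxM mulmxA -[u *m _ *m _]mulmxA.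
  by rewrite (unitarymxP PU) mulmx1.
have d_le i : `|d 0 i| <= lambda%:C%C.
  rewrite normc_def lecR; apply: le_trans rhoA.
  suff : eigenvalue Ac (d 0 i).
    by move/normc_le_spectral_radius; case: (d 0 i).
  (* Row [i] of [P] is a left eigenvector for [d 0 i]; it is nonzero because [P] is unitary. *)
  apply/eigenvalueP; exists (row i P).
    rewrite -row_mul AcE !mulmxA mulmxV// mul1mx row_mul.
    by rewrite row_diag_mx -scalemxAl -rowE.
  apply/eqP => Pi0.
  have := congr1 (fun B : 'M[C]_c => row i B) (unitarymxP PU).
  rewrite row_mul Pi0 mul0mx => /rowP/(_ i)/eqP.
  by rewrite !mxE eqxx eq_sym oner_eq0.
rewrite -lecR rmorphM rmorphXn/= -!nsq_toC /toC map_mxM -/(toC _ _ _) -/Ac.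
set y := toC _ _ x *m invmx P.
have -> : toC _ _ x *m Ac = (y *m diag_mx d) *m P by rewrite AcE !mulmxA.
have -> : toC _ _ x = y *m P by rewrite mulmxKV.
rewrite !nsqP !nsqE mulr_sumr; apply: ler_sum => i _.
rewrite mul_mx_diag mxE normrM exprMn mulrC ler_wpM2r ?exprn_ge0//.
by rewrite lerXn2r ?nnegrE ?normr_ge0 ?(le_trans (normr_ge0 _) (d_le i)).
Qed.
End SpectralBound.

(** * Error of a consensus phase and the number of rounds *)

Section Consensus.
Variable R : realType.

Definition sqr_frobenius m n (X : 'M[R]_(m, n)) : R :=
  \sum_i dot (row i X) (row i X).

Lemma dot_row_le_frobenius m n (X : 'M[R]_(m, n)) a :
  dot (row a X) (row a X) <= sqr_frobenius X.
Proof.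
by rewrite /sqr_frobenius (bigD1 a)//= lerDl sumr_ge0// => *; exact: dot_ge0.
Qed.

Lemma sqr_frobenius_tr m n (X : 'M[R]_(m, n)) :
  sqr_frobenius X^T = sqr_frobenius X.
Proof.
rewrite /sqr_frobenius (eq_bigr (fun i => \sum_j X j i ^+ 2)) => [|i _].
  rewrite exchange_big; apply: eq_bigr => i _.
  by rewrite dotE; apply: eq_bigr => j _; rewrite mxE expr2.
by rewrite dotE; apply: eq_bigr => j _; rewrite !mxE expr2.
Qed.

Lemma sqr_frobenius_symmetric m n (A : 'M[R]_m) lambda (X : 'M[R]_(m, n)) :
  A^T = A -> spectral_radius A <= lambda ->
  sqr_frobenius (A *m X) <= lambda ^+ 2 * sqr_frobenius X.
Proof.
move=> symA rhoA; rewrite -[sqr_frobenius (A *m X)]sqr_frobenius_tr.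
rewrite -[sqr_frobenius X]sqr_frobenius_tr trmx_mul symA mulr_sumr.
by apply: ler_sum => i _; rewrite row_mul symmetric_mulmx_bound.
Qed.

Lemma mulmx_const_fixed c (V : 'M[R]_c) (a : R) :
  V *m const_mx 1 = const_mx 1 :> 'cV[R]_c ->
  V *m const_mx a = const_mx a :> 'M[R]_c.
Proof.
have -> : const_mx a = (const_mx 1 : 'cV[R]_c) *m (const_mx a : 'rV[R]_c).
  by apply/matrixP => i j; rewrite !mxE big_ord1 !mxE mul1r.
by rewrite mulmxA => ->.
Qed.

(* On families of mean zero [V] acts as [V - 1 1^T / c], and it preserves    *)
(* mean zero.                                                                *)
Lemma sqr_frobenius_consensus c M (G : rel 'I_c) lambda (V : 'M[R]_c) theta
    (X : 'M[R]_(c, M)) :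
  consensus_matrix G lambda V ->
  (const_mx c%:R^-1 : 'M[R]_c) *m X = 0 ->
  sqr_frobenius (V ^+ theta *m X) <= lambda ^+ (2 * theta) * sqr_frobenius X.
Proof.
move=> [_ V1 symV rhoV]; set A := const_mx _ => AX0.
have symA : A^T = A by apply/matrixP => i j; rewrite !mxE.
have VA : V *m A = A := mulmx_const_fixed _ V1.
have AV : A *m V = A by rewrite -[LHS]trmxK trmx_mul symA symV VA symA.
elim: theta X AX0 => [|t IH] X AX0; first by rewrite mul1mx mul1r.
have AVX0 : A *m (V *m X) = 0 by rewrite mulmxA AV.
rewrite exprSr -mulmxE -mulmxA (le_trans (IH _ AVX0))//.
rewrite mulnS addnC exprD -mulrA ler_wpM2l//.
  by rewrite exprM exprn_ge0 ?sqr_ge0.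
have -> : V *m X = (V - A) *m X by rewrite mulmxBl AX0 subr0.
by rewrite sqr_frobenius_symmetric// linearB/= symA symV.
Qed.

(** [V] fixes the mean [A *m W], so only the centered part [X] of [W] is left in the error. Its
    Frobenius norm contracts by [lambda] at each round. Each of its [c] rows averages differences of
    rows of [W], hence has norm at most [upsilon]; the other factor [c ^+ 2] comes from scaling by
    [c]. *)
Lemma consensus_error c M (G : rel 'I_c) lambda (V : 'M[R]_c) theta
    (W : 'M[R]_(c, M)) upsilon (a : 'I_c) :
  consensus_matrix G lambda V ->
  (forall b b', enorm (row b W - row b' W) <= upsilon) ->
  enorm (c%:R *: row a (V ^+ theta *m W) - \sum_b row b W) ^+ 2
    <= c%:R ^+ 3 * (lambda ^+ (2 * theta) * upsilon ^+ 2).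
Proof.
move=> cV; case: (cV) => _ V1 _ _ ups.
have c0 : (c%:R : R) != 0.
  by rewrite pnatr_eq0 -lt0n (leq_ltn_trans _ (ltn_ord a)).
have u0 : 0 <= upsilon by rewrite (le_trans _ (ups a a))// enorm_ge0.
pose A : 'M[R]_c := const_mx c%:R^-1.
have rowAW b : row b (A *m W) = c%:R^-1 *: \sum_b' row b' W.
  rewrite row_mul mulmx_sum_row scaler_sumr.
  by apply: eq_bigr => i _; rewrite !mxE.
have AA : A *m A = A.
  apply/matrixP => i j; rewrite !mxE (eq_bigr (fun=> c%:R^-1 * c%:R^-1)).
    by rewrite sumr_const card_ord -[_ * _ *+ _]mulr_natl mulrA divff ?mul1r.
  by move=> k _; rewrite !mxE.
have VtA : V ^+ theta *m A = A.
  elim: theta => [|t IH]; first by rewrite mul1mx.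
  by rewrite exprSr -mulmxE -mulmxA mulmx_const_fixed.
pose X := W - A *m W.
have -> : c%:R *: row a (V ^+ theta *m W) - \sum_b row b W
          = c%:R *: row a (V ^+ theta *m X).
  rewrite mulmxBr mulmxA VtA linearB/= scalerBr rowAW scalerA divff//.
  by rewrite scale1r.
rewrite sqr_enorm dotZl dotZr mulrA -expr2 [_ ^+ 3]exprSr -mulrA.
rewrite ler_wpM2l ?sqr_ge0// (le_trans (dot_row_le_frobenius _ _))//.
have AX0 : A *m X = 0 by rewrite mulmxBr mulmxA AA subrr.
rewrite (le_trans (sqr_frobenius_consensus _ cV AX0))// mulrCA.
rewrite ler_wpM2l//; first by rewrite exprM exprn_ge0 ?sqr_ge0.
rewrite mulr_natl -[X in _ <= _ *+ X]card_ord -sumr_const ler_sum// => b _.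
rewrite -sqr_enorm lerXn2r ?nnegrE ?enorm_ge0// linearB/= rowAW.
have -> : row b W - c%:R^-1 *: (\sum_b' row b' W)
          = c%:R^-1 *: \sum_b' (row b W - row b' W).
  rewrite sumrB scalerBr sumr_const card_ord -[row b W *+ _]scaler_nat.
  rewrite scalerA mulVf//.
  by rewrite scale1r.
rewrite enormZ ger0_norm ?invr_ge0// ler_pdivrMl ?lt_def ?c0//=.
rewrite (le_trans (ler_enorm_sum _ _ _))//.
by rewrite mulr_natl -[X in _ *+ X]card_ord -sumr_const ler_sum.
Qed.

(** The criterion is this inequality after taking logarithms. When [s] exceeds
    [c ^+ 3 * upsilon ^+ 2] it asks nothing, and [lambda ^+ (2 * theta) <= 1] suffices. *)
Lemma enough_rounds_bound (s upsilon lambda : R) c theta :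
  (0 < c)%N -> 0 <= s -> 0 <= upsilon -> 0 < lambda < 1 ->
  enough_rounds s upsilon lambda c theta ->
  c%:R ^+ 3 * (lambda ^+ (2 * theta) * upsilon ^+ 2) <= s.
Proof.
move=> c0 s0 u0 /andP[l0 l1]; rewrite /enough_rounds.
have c0R : 0 < (c%:R : R) by rewrite ltr0n.
have [sle|slt] := leP s (c%:R ^+ 3 * upsilon ^+ 2); last first.
  move=> _; apply: le_trans (ltW slt); rewrite ler_wpM2l ?exprn_ge0 //.
  by rewrite ler_piMl ?sqr_ge0// exprn_ile1 ?(ltW l0) ?(ltW l1).
move=> /(_ isT); have [->|sn0] := eqVneq s 0.
  by move=> ->; rewrite expr0n !mulr0.
have sp : 0 < s by rewrite lt_def sn0.
have up : 0 < upsilon.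
  rewrite lt_def u0 andbT; apply: contraTneq sle => ->.
  by rewrite expr0n mulr0 -ltNge.
have lnl : ln lambda < 0 by rewrite ln_lt0// l0.
set p := c%:R `^ (3 / 2).
have pp : 0 < p by rewrite powR_gt0.
have p2 : p ^+ 2 = c%:R ^+ 3.
  rewrite /p -powR_mulrn ?powR_ge0// -powRrM -powR_mulrn ?ltW//.
  by congr (_ `^ _); lra.
rewrite ceil_le_int => h.
have : 2 * theta%:R * ln lambda <= ln s - 2 * ln (p * upsilon).
  (* [2 * ln lambda] is negative, so clearing it reverses the inequality. *)
  move: h; rewrite ler_ndivrMr; last by lra.
  by rewrite -pmulrn; lra.
move=> {}h; rewrite -ler_ln ?posrE ?mulr_gt0 ?exprn_gt0//.
rewrite -p2 mulrCA -exprMn lnM ?posrE ?exprn_gt0 ?mulr_gt0// !lnXn ?mulr_gt0//.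
by rewrite -[_ *+ (2 * theta)]mulr_natl -[_ *+ 2]mulr_natl natrM; lra.
Qed.

End Consensus.

(** * Gradient descent with an additive perturbation *)

Section Descent.
Variables (R : realType) (M : nat).
Implicit Types (F : 'rV[R]_M -> R) (x y v w : 'rV[R]_M).

Lemma derive_dot_grad F x v :
  differentiable F x -> 'D_v F x = dot (grad F x) v.
Proof.
move=> dF; rewrite deriveE// [in LHS](row_sum_delta v) linear_sum dotE.
by apply: eq_bigr => i _; rewrite linearZ/= mxE deriveE// mulrC.
Qed.

Lemma is_derive_line F x v (t : R) : differentiable F (t *: v + x) ->
  is_derive t 1 (fun s : R => F (s *: v + x)) (dot (grad F (t *: v + x)) v).
Proof.
move=> dF; rewrite -derive_dot_grad//.
have e : (fun h : R => h^-1 *: (((fun s : R => F (s *: v + x)) \o shift t)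
             (h *: 1) - F (t *: v + x))) =
         (fun h : R => h^-1 *: ((F \o shift (t *: v + x)) (h *: v)
             - F (t *: v + x))).
  by apply/funext => h /=; rewrite [h%:A]mulr1 scalerDl addrA.
split; last by rewrite /derive e.
by rewrite /derivable e; exact: diff_derivable.
Qed.

(** The mean value theorem is applied to [g], the restriction of [F] to the segment minus the
    quadratic model; smoothness and Cauchy-Schwarz make its derivative nonpositive. *)
Lemma smooth_descent F eta x y : 0 <= eta ->
  (forall z, differentiable F z) -> smooth eta F ->
  F y <= F x + dot (grad F x) (y - x) + eta / 2 * enorm (y - x) ^+ 2.
Proof.
move=> eta0 dF sF; set v := y - x.
pose a := dot (grad F x) v; pose b := eta / 2 * enorm v ^+ 2.
pose g : R -> R :=
  (fun s => F (s *: v + x)) - (a \*: @idfun R) - (b \*: (@idfun R * @idfun R)).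
have gE s : g s = F (s *: v + x) - a * s - b * (s * s) by [].
pose dg (t : R) := dot (grad F (t *: v + x)) v - a - b * (t + t).
have g_dg (t : R) : is_derive t 1 g (dg t).
  have d1 := is_derive_line (dF (t *: v + x)).
  have di := is_derive_id t (1 : R).
  apply: (is_derive_eq (is_deriveB (is_deriveB d1 (is_deriveZ a di))
                                   (is_deriveZ b (is_deriveM di di)))).
  by rewrite /dg /= /GRing.scale/= !mulr1.
have [t] : exists2 t, t \in `]0, 1[ & g 1 - g 0 = dg t * (1 - 0).
  apply: MVT => //; apply: derivable_within_continuous => t _.
  by have [] := g_dg t.
rewrite in_itv/= => /andP[t0 t1]; rewrite subr0 mulr1 => gMVT.
have : dg t <= 0.
  have := dot_le_enorm (grad F (t *: v + x) - grad F x) v.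
  rewrite dotDl dotNl => h1.
  have h2 : enorm (grad F (t *: v + x) - grad F x) * enorm v <=
            eta * (t * enorm v) * enorm v.
    rewrite ler_wpM2r ?enorm_ge0// (le_trans (sF _ _))// addrK enormZ.
    by rewrite gtr0_norm.
  by rewrite /dg /b /a; nra.
rewrite -gMVT !gE scale1r scale0r add0r subrK /b /a; lra.
Qed.

(** Completing the square in the quadratic lower bound for [F y]. *)
Lemma strongly_convex_polyak_lojasiewicz F mu x y :
  0 < mu -> strongly_convex mu F ->
  2 * mu * (F x - F y) <= enorm (grad F x) ^+ 2.
Proof.
move=> mu0 /(_ x y) h.
have := dot_ge0 (grad F x + mu *: (y - x)).
rewrite dotDl !dotDr !dotZl !dotZr -!sqr_enorm (dotC _ (grad F x)) => h1.
have : mu * (F x + dot (y - x) (grad F x) + mu / 2 * enorm (y - x) ^+ 2)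
       <= mu * F y by rewrite ler_wpM2l// ltW.
rewrite (dotC _ (grad F x)); lra.
Qed.

(** In the descent inequality the linear term contributes [dot (grad F x) e] and the quadratic one
    its opposite, precisely because the step is [1 / eta]. *)
Lemma perturbed_step F eta x e : 0 < eta ->
  (forall z, differentiable F z) -> smooth eta F ->
  F (x - (1 / eta) *: grad F x + e)
    <= F x - enorm (grad F x) ^+ 2 / (2 * eta) + eta / 2 * enorm e ^+ 2.
Proof.
move=> eta0 dF sF.
have := smooth_descent x (x - (1 / eta) *: grad F x + e) (ltW eta0) dF sF.
have -> : x - (1 / eta) *: grad F x + e - x = e - (1 / eta) *: grad F x.
  by rewrite addrAC [x - _]addrC addrK addrC.
move=> /le_trans; apply; rewrite -!addrA lerD2l.
rewrite !sqr_enorm !(dotDl, dotDr, dotNl, dotNr, dotZl, dotZr).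
rewrite (dotC e (grad F x)) le_eqVlt; apply/orP; left; apply/eqP; field.
by rewrite gt_eqF.
Qed.

End Descent.

(** * Differentiability and gradient of the weighted global loss *)

Section GlobalLoss.
Variables (R : realType) (M : nat).

Lemma is_derive_weighted_sum (T : Type) (r : seq T) (c : T -> R)
    (f : T -> 'rV[R]_M -> R) x v :
  (forall n, differentiable (f n) x) ->
  is_derive x v (fun w => \sum_(n <- r) c n * f n w)
                (\sum_(n <- r) c n * 'D_v (f n) x).
Proof.
move=> df; elim: r => [|n r IH].
  rewrite big_nil; under eq_fun do rewrite big_nil; exact: is_derive_cst.
rewrite big_cons; under eq_fun do rewrite big_cons.
apply: is_deriveD; apply: is_deriveZ; apply: derivableP.
exact: diff_derivable.
Qed.

Lemma differentiable_weighted_sum (T : Type) (r : seq T) (c : T -> R)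
    (f : T -> 'rV[R]_M -> R) x :
  (forall n, differentiable (f n) x) ->
  differentiable (fun w => \sum_(n <- r) c n * f n w) x.
Proof.
move=> df; elim: r => [|n r IH].
  under eq_fun do rewrite big_nil; exact: differentiable_cst.
under eq_fun do rewrite big_cons.
by apply: differentiableD => //; exact: differentiableZ.
Qed.

Lemma differentiable_global_loss (T : finType) (data : T -> finType)
    (f : T -> 'rV[R]_M -> R) x :
  (forall n, differentiable (f n) x) -> differentiable (global_loss data f) x.
Proof.
move=> df; rewrite /global_loss; apply: differentiableZ.
exact: differentiable_weighted_sum.
Qed.

Lemma grad_global_loss (T : finType) (data : T -> finType)
    (f : T -> 'rV[R]_M -> R) x :
  (forall n, differentiable (f n) x) ->
  grad (global_loss data f) x =
    (total_data data)%:R^-1 *: \sum_n #|data n|%:R *: grad (f n) x.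
Proof.
move=> df; apply/rowP => i; rewrite !mxE summxE.
under eq_bigr do rewrite !mxE.
have := is_deriveZ (1 / (total_data data)%:R)
  (is_derive_weighted_sum (index_enum T) (fun n => #|data n|%:R)
     (delta_mx 0 i) df).
by move=> [_ ->]; rewrite mul1r.
Qed.

End GlobalLoss.

(** * Aggregation errors through the layers *)

Section Aggregation.
Variables (R : realType) (M : nat).

Lemma cluster_error (T : finType) (C : {set T}) (v : T -> 'rV[R]_M)
    (G : rel 'I_#|C|) (V : 'M[R]_#|C|) (lambda upsilon s : R) theta a :
  consensus_matrix G lambda V -> 0 < lambda < 1 -> 0 <= s ->
  (forall q q', q \in C -> q' \in C -> enorm (v q - v q') <= upsilon) ->
  enough_rounds s upsilon lambda #|C| theta ->
  enorm (#|C|%:R *: row a (V ^+ theta *m cluster_mx C v) - \sum_(i in C) v i)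
    ^+ 2 <= s.
Proof.
move=> cV lam s0 ups rounds.
have C0 : (0 < #|C|)%N := leq_ltn_trans (leq0n _) (ltn_ord a).
have row_cluster b : row b (cluster_mx C v) = v (enum_val b).
  by apply/rowP => j; rewrite !mxE.
have u0 : 0 <= upsilon.
  by rewrite (le_trans (enorm_ge0 _) (ups _ _ (enum_valP a) (enum_valP a))).
apply: le_trans (enough_rounds_bound C0 s0 u0 lam rounds).
have -> : \sum_(i in C) v i = \sum_b row b (cluster_mx C v).
  by rewrite big_enum_val; apply: eq_bigr => b _; rewrite row_cluster.
apply: consensus_error cV _ => b b'.
by rewrite !row_cluster ups ?enum_valP.
Qed.

Lemma sum_children (J : nat) (node : nat -> finType)
    (Q : forall (k j : nat), node j -> {set node j.+1}) k j
    (g : node j.+1 -> 'rV[R]_M) :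
  is_network J Q -> (1 <= k)%N -> (j < J)%N ->
  \sum_n \sum_(i in Q k j n) g i = \sum_i g i.
Proof.
move=> [_ _ /(_ k j)] part k1 jJ; have [_ disj cov] := part k1 jJ.
rewrite -partition_disjoint_bigcup => [|n n' nn'].
  by rewrite cov; apply: eq_bigl => i; rewrite inE.
by rewrite -setI_eq0 disj.
Qed.

(** The sum over layer [j] minus the sum over layer [j.+1] is the sum of the local discrepancies at
    layer [j], as the children partition the next layer; these differences telescope. *)
Lemma sum_layers (J : nat) (node : nat -> finType)
    (Q : forall (k j : nat), node j -> {set node j.+1}) k
    (u : forall j, node j -> 'rV[R]_M) m :
  is_network J Q -> (1 <= k)%N -> (m <= J)%N ->
  \sum_(n : node 0%N) u 0%N n = \sum_(n : node m) u m n +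
    \sum_(j < m) \sum_(n : node j) (u j n - \sum_(i in Q k j n) u j.+1 i).
Proof.
move=> net k1; elim: m => [|m IH] mJ; first by rewrite big_ord0 addr0.
rewrite (IH (ltnW mJ)) big_ord_recr/= sumrB (sum_children _ net)//.
by rewrite [RHS]addrC -addrA subrK addrC.
Qed.

Lemma sqr_enorm_layered_sum (J : nat) (node : nat -> finType)
    (e : forall j, node j -> 'rV[R]_M) (s : nat -> R) :
  (forall j (n : node j), (j < J)%N -> enorm (e j n) ^+ 2 <= s j.+1) ->
  enorm (\sum_(j < J) \sum_(n : node j) e j n) ^+ 2
    <= (\sum_(j < J) #|node j|%:R) * \sum_(j < J) s j.+1 * #|node j|%:R.
Proof.
move=> es.
(* One index per cluster, represented by its parent: the triangle inequality and Cauchy-Schwarz are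
   used once over this whole family. *)
pose I := {j : 'I_J & node j}.
have cardI : #|{: I}|%:R = \sum_(j < J) #|node j|%:R :> R.
  by rewrite card_tagged sumnE big_map big_enum natr_sum.
rewrite -cardI.
have -> : \sum_(j < J) s j.+1 * #|node j|%:R = \sum_(p : I) s (tag p).+1.
  transitivity (\sum_(j < J) \sum_(n : node j) s j.+1).
    by apply: eq_bigr => j _; rewrite sumr_const mulr_natr.
  by rewrite sig_big_dep.
rewrite sig_big_dep/=.
have h : enorm (\sum_(p : I) e (tag p) (tagged p)) ^+ 2
         <= (\sum_(p : I) enorm (e (tag p) (tagged p))) ^+ 2.
  by rewrite lerXn2r ?nnegrE ?enorm_ge0 ?sumr_ge0 ?ler_enorm_sum// => *;
    exact: enorm_ge0.
apply: le_trans h _; apply: le_trans (sqr_sum_le_card _) _.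
by rewrite ler_wpM2l// ler_sum// => p _; exact: es.
Qed.

End Aggregation.

(** * Recursion on the optimality gap and conclusion *)

Lemma affine_recursion_le (R : realFieldType) (g : nat -> R) (r b : R) n :
  0 <= r -> r != 1 -> (forall k, g k.+1 <= r * g k + b) ->
  g n <= r ^+ n * g 0%N + b * (1 - r ^+ n) / (1 - r).
Proof.
move=> r0 r1 step; have r1' : 1 - r != 0 by rewrite subr_eq0 eq_sym.
elim: n => [|n IH]; first by rewrite expr0 subrr mulr0 mul0r addr0 mul1r.
apply: le_trans (step n) _.
have -> : r ^+ n.+1 * g 0%N + b * (1 - r ^+ n.+1) / (1 - r)
        = r * (r ^+ n * g 0%N + b * (1 - r ^+ n) / (1 - r)) + b.
  by rewrite exprS; field.
by rewrite lerD2r ler_wpM2l.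
Qed.

Lemma mhfl_iteration_error (R : realType) (M J : nat)
  (node : nat -> finType) (server : node 0%N)
  (Q : forall (k j : nat), node j -> {set node j.+1})
  (data : node J -> finType) (f : node J -> 'rV[R]_M -> R) (beta : R)
  (lut : forall (k j : nat), node j -> bool)
  (G : forall (k j : nat) (n : node j), rel 'I_#|Q k j n|)
  (theta : forall (k j : nat), node j -> nat)
  (lambda : forall (k j : nat), node j -> R)
  (V : forall (k j : nat) (n : node j), 'M[R]_#|Q k j n|)
  (w0 : 'rV[R]_M) (w : nat -> 'rV[R]_M)
  (wt : forall (k j : nat), node j -> 'rV[R]_M)
  (upsilon : forall (k j : nat), node j -> R) (s : nat -> R) (k : nat) :
  (1 <= k)%N -> is_network J Q -> (0 < total_data data)%N ->
  (forall n x, differentiable (f n) x) ->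
  (forall j (n : node j), (j < J)%N -> lut k j n ->
     0 < lambda k j n < 1 /\
     consensus_matrix (@G k j n) (lambda k j n) (V k j n)) ->
  mhfl_run server data f beta lut V theta w0 w wt ->
  (forall j (n : node j), (j < J)%N ->
     forall q q', q \in Q k j n -> q' \in Q k j n ->
       enorm (wt k j.+1 q - wt k j.+1 q') <= upsilon k j n) ->
  (forall j, (1 <= j <= J)%N -> 0 <= s j) ->
  round_criterion J Q lut theta lambda upsilon s k ->
  exists2 e,
    w k = w k.-1 - beta *: grad (global_loss data f) (w k.-1) + e
  & (total_data data)%:R ^+ 2 * enorm e ^+ 2
      <= (\sum_(j < J) #|node j|%:R) * \sum_(j < J) s j.+1 * #|node j|%:R.
Proof.
move=> k1 net D0 df hV [_ /(_ k k1)[leaf eut hlut wk]] ups s0 crit.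
have D0R : (total_data data)%:R != 0 :> R by rewrite pnatr_eq0 -lt0n.
(* The discrepancy at a parent; it is zero when the cluster is EUT. *)
pose e j (n : node j) := wt k j n - \sum_(i in Q k j n) wt k j.+1 i.
pose E := \sum_(j < J) \sum_(n : node j) e j n.
exists ((total_data data)%:R^-1 *: E); last first.
  rewrite enormZ exprMn normfV ger0_norm ?ler0n// exprVn mulrA.
  rewrite divff; last by rewrite expf_eq0.
  rewrite mul1r; apply: sqr_enorm_layered_sum => j n jJ.
  have s1 : 0 <= s j.+1 by rewrite s0.
  have [lt|nlt] := boolP (lut k j n); last first.
    by rewrite /e eut// subrr enorm0 expr0n.
  have [a wtE] := hlut j n jJ lt; have [lam cV] := hV j n jJ lt.
  rewrite /e wtE; apply: cluster_error cV lam s1 (ups j n jJ) _.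
  exact: crit.
have serverE : \sum_(n : node 0%N) wt k 0%N n = wt k 0%N server.
  have [_ /eqP card1 _] := net.
  have /fintype_le1P all_eq : (#|node 0%N| <= 1)%N by rewrite (eqP card1).
  by rewrite (big_pred1 server)// => n; rewrite /= (all_eq n server) eqxx.
(* The sum over the end devices, divided by the total data size, is the exact gradient step. *)
rewrite wk -serverE (sum_layers (wt k) net k1 (leqnn J)) -/e scalerDr.
congr (_ + _); rewrite grad_global_loss//.
rewrite (eq_bigr _ (fun n _ => leaf n)).
under eq_bigr do rewrite scalerBr scalerA mulrC -scalerA.
rewrite sumrB scalerBr -scaler_suml -natr_sum scalerA mulVf// scale1r.
by rewrite -scaler_sumr !scalerA mulrC.
Qed.

Theorem corollary1 (R : realType) (M J : nat) (hJ : (1 <= J)%N)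
  (* network *)
  (node : nat -> finType) (server : node 0%N)
  (Q : forall (k j : nat), node j -> {set node j.+1})
  (hnet : is_network J Q)
  (* losses *)
  (data : node J -> finType) (hdata : forall n, (0 < #|data n|)%N)
  (f : node J -> 'rV[R]_M -> R)
  (hf : forall n x, differentiable (f n) x)
  (mu eta : R) (hmu : 0 < mu) (hmueta : mu < eta)
  (hsc : strongly_convex mu (global_loss data f))
  (hsm : smooth eta (global_loss data f))
  (wstar : 'rV[R]_M)
  (hstar : forall x, global_loss data f wstar <= global_loss data f x)
  (* D2D consensus *)
  (lut : forall (k j : nat), node j -> bool)
  (G : forall (k j : nat) (n : node j), rel 'I_#|Q k j n|)
  (theta : forall (k j : nat), node j -> nat)
  (lambda : forall (k j : nat), node j -> R)
  (V : forall (k j : nat) (n : node j), 'M[R]_#|Q k j n|)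
  (hV : forall k j (n : node j), (1 <= k)%N -> (j < J)%N -> lut k j n ->
     [/\ connected_graph (@G k j n),
         0 < lambda k j n < 1
       & consensus_matrix (@G k j n) (lambda k j n) (V k j n)])
  (* a realization of MH-FL *)
  (beta : R) (hbeta : beta = 1 / eta)
  (w0 : 'rV[R]_M) (w : nat -> 'rV[R]_M)
  (wt : forall (k j : nat), node j -> 'rV[R]_M)
  (hrun : mhfl_run server data f beta lut V theta w0 w wt)
  (upsilon : forall (k j : nat), node j -> R)
  (hups : forall k j (n : node j), (1 <= k)%N -> (j < J)%N ->
     forall q q', q \in Q k j n -> q' \in Q k j n ->
       enorm (wt k j.+1 q - wt k j.+1 q') <= upsilon k j n)
  (* target accuracy *)
  (kappa : nat) (hkappa : (1 <= kappa)%N) (eps : R) :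
  let F := global_loss data f in
  let gap0 := F w0 - F wstar in
  let D : R := (total_data data)%:R in
  let Phi : R := \sum_(j < J) #|node j|%:R in
  (1 - mu / eta) ^+ kappa * gap0 <= eps < gap0 ->
  ((exists sigma : nat -> R,
      [/\ forall j, (1 <= j <= J)%N -> 0 <= sigma j,
          \sum_(j < J) sigma j.+1 * #|node j|%:R
            <= (eps - (1 - mu / eta) ^+ kappa * gap0)
               / ((1 - (1 - mu / eta) ^+ kappa)
                  * (eta ^+ 2 * Phi / (2 * mu * D ^+ 2)))
        & forall k, (1 <= k)%N ->
            round_criterion J Q lut theta lambda upsilon sigma k])
   -> F (w kappa) - F wstar <= eps)
  /\
  ((exists (delta : R) (sigma : nat -> nat -> R),
      [/\ 0 < delta <= mu / eta,
          delta >= 1 - (eps / gap0) `^ (1 / kappa%:R)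
        & forall k, (1 <= k)%N ->
            [/\ forall j, (1 <= j <= J)%N -> 0 <= sigma k j,
                \sum_(j < J) sigma k j.+1 * #|node j|%:R
                  <= D ^+ 2 * mu * (mu - delta * eta) / (eta ^+ 4 * Phi)
                     * enorm (grad F (w k.-1)) ^+ 2
              & round_criterion J Q lut theta lambda upsilon (sigma k) k]])
   -> F (w kappa) - F wstar <= eps).
Proof.
move=> F gap0 D Phi /andP[eps_ge eps_lt].
have eta0 : 0 < eta := lt_trans hmu hmueta.
have q01 : 0 < mu / eta < 1 by rewrite divr_gt0//= ltr_pdivrMr// mul1r.
have r01 : 0 < 1 - mu / eta < 1 by move: q01 => /andP[? ?]; lra.
have D0 : (0 < total_data data)%N.
  have [/(_ J (leqnn J))/card_gt0P[n _] _ _] := hnet.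
  by rewrite /total_data (bigD1 n)//= ltn_addr.
have DR : 0 < D by rewrite ltr0n.
have Phi0 : 0 < Phi.
  rewrite /Phi (bigD1 (Ordinal hJ))//= ltr_wpDr ?sumr_ge0// ltr0n.
  by have [_ -> _] := hnet.
have dF x : differentiable F x by exact: differentiable_global_loss.
have w0E : w 0%N = w0 by case: hrun.
pose gap k := F (w k) - F wstar.
have gap_ge0 k : 0 <= gap k by rewrite subr_ge0.
have gap0E : gap 0%N = gap0 by rewrite /gap w0E.
(* With a zero initial gap the interval allowed for [eps] would be empty. *)
have gap0_gt0 : 0 < gap0.
  rewrite lt_def -gap0E gap_ge0 andbT gap0E; apply: contraTneq eps_lt => g0.
  by rewrite g0 -leNgt (le_trans _ eps_ge)// g0 mulr0.
have eps0 : 0 < eps.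
  apply: lt_le_trans eps_ge; rewrite mulr_gt0// exprn_gt0//.
  by case/andP: r01.
have step k s : (forall j, (1 <= j <= J)%N -> 0 <= s j) ->
    round_criterion J Q lut theta lambda upsilon s k.+1 ->
    gap k.+1 <= gap k - enorm (grad F (w k)) ^+ 2 / (2 * eta)
      + eta / 2 * (Phi * (\sum_(j < J) s j.+1 * #|node j|%:R) / D ^+ 2).
  move=> s0 crit.
  have hV' j (n : node j) : (j < J)%N -> lut k.+1 j n ->
      0 < lambda k.+1 j n < 1 /\
      consensus_matrix (@G k.+1 j n) (lambda k.+1 j n) (V k.+1 j n).
    by move=> jJ lt; have [] := hV k.+1 j n isT jJ lt.
  have ups j (n : node j) : (j < J)%N ->
      forall q q', q \in Q k.+1 j n -> q' \in Q k.+1 j n ->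
      enorm (wt k.+1 j.+1 q - wt k.+1 j.+1 q') <= upsilon k.+1 j n.
    by move=> jJ; exact: hups.
  have [e wE eD] :=
    mhfl_iteration_error (ltn0Sn k) hnet D0 hf hV' hrun ups s0 crit.
  have := perturbed_step (w k) e eta0 dF hsm.
  rewrite -hbeta -wE -/F /gap => h.
  have : enorm e ^+ 2
      <= Phi * (\sum_(j < J) s j.+1 * #|node j|%:R) / D ^+ 2.
    by rewrite ler_pdivlMr ?exprn_gt0// mulrC.
  rewrite -(ler_pM2l (_ : 0 < eta / 2)) ?divr_gt0//; lra.
have PL k : 2 * mu * gap k <= enorm (grad F (w k)) ^+ 2.
  exact: strongly_convex_polyak_lojasiewicz.
split.
- case=> s [s0 sS crit].
  set S := \sum_(j < J) _ in sS.
  set r := 1 - mu / eta in r01 eps_ge sS *.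
  have /andP[r0 r1] := r01.
  have rk1 : 0 < 1 - r ^+ kappa by rewrite subr_gt0 exprn_ilt1 ?ltW// -lt0n.
  (* Here the whole gradient decrease is traded for [mu / eta * gap k]. *)
  have contraction k : gap k.+1 <= r * gap k + eta / 2 * (Phi * S / D ^+ 2).
    apply: le_trans (step k s s0 (crit k.+1 isT)) _; rewrite lerD2r.
    have -> : r * gap k = gap k - 2 * mu * gap k / (2 * eta).
      by rewrite /r; field; rewrite gt_eqF.
    by rewrite lerD2l lerN2 ler_wpM2r ?PL// invr_ge0 mulr_ge0// ltW.
  have := affine_recursion_le kappa (ltW r0) (negbT (lt_eqF r1)) contraction.
  move/le_trans; apply; rewrite gap0E -lerBrDl.
  (* Once its denominator is cleared, the left side of the budget is exactly the accumulated error,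
     since [1 - r = mu / eta]. *)
  move: sS; rewrite ler_pdivlMr; last first.
    by rewrite mulr_gt0// divr_gt0// !mulr_gt0// exprn_gt0.
  move/(le_trans _); apply; rewrite le_eqVlt; apply/orP; left; apply/eqP.
  have -> : 1 - r = mu / eta by rewrite /r; ring.
  by field; rewrite !gt_eqF.
- case=> delta [s [/andP[delta0 delta_le] delta_ge h]].
  have contraction k : gap k.+1 <= (1 - delta) * gap k.
    have [s0 sS crit] := h k.+1 isT.
    apply: le_trans (step k (s k.+1) s0 crit) _.
    set S := \sum_(j < J) _ in sS *; set g2 := enorm _ ^+ 2.
    have Sg : eta / 2 * (Phi * S / D ^+ 2)
           <= mu * (mu - delta * eta) / (2 * eta ^+ 3) * g2.
      move: sS.
      rewrite -(ler_pM2l (_ : 0 < eta / 2 * (Phi / D ^+ 2))); last first.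
        by rewrite mulr_gt0 ?divr_gt0// exprn_gt0.
      have -> : eta / 2 * (Phi / D ^+ 2) * S = eta / 2 * (Phi * S / D ^+ 2).
        by field; rewrite gt_eqF.
      move/le_trans; apply; rewrite le_eqVlt; apply/orP; left; apply/eqP.
      by rewrite -/F -/g2; field; rewrite !gt_eqF.
    set q := mu / eta in q01 r01 delta_le *; have /andP[q0 q1] := q01.
    (* The error takes at most the fraction [q * (q - delta)] of the decrease [g2 / (2 * eta)]. *)
    have cE : mu * (mu - delta * eta) / (2 * eta ^+ 3)
            = q * (q - delta) / (2 * eta).
      by rewrite /q; field; rewrite gt_eqF.
    rewrite cE in Sg.
    have PLk : 2 * mu * gap k <= g2 := PL k.
    have : gap k - g2 / (2 * eta) + q * (q - delta) / (2 * eta) * g2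
        <= (1 - delta) * gap k.
      have -> : gap k - g2 / (2 * eta) + q * (q - delta) / (2 * eta) * g2
              = gap k - (1 - q * (q - delta)) / (2 * eta) * g2.
        by field; rewrite gt_eqF.
      have c0 : 0 <= (1 - q * (q - delta)) / (2 * eta).
        rewrite divr_ge0 ?mulr_ge0 ?ltW//; nra.
      have h1 := ler_wpM2l c0 PLk.
      have h2 : (1 - q * (q - delta)) / (2 * eta) * (2 * mu * gap k)
              = q * (1 - q * (q - delta)) * gap k.
        by rewrite /q; field; rewrite gt_eqF.
      (* The two coefficients differ by [(q - delta) * (1 - q ^+ 2)]. *)
      have h3 : delta * gap k <= q * (1 - q * (q - delta)) * gap k.
        rewrite ler_wpM2r//; have := mulr_ge0 (_ : 0 <= q - delta)
          (_ : 0 <= 1 - q ^+ 2); nra.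
      lra.
    lra.
  have d1 : 0 <= 1 - delta by case/andP: q01 => *; lra.
  have geo n : gap n <= (1 - delta) ^+ n * gap0.
    elim: n => [|n IH]; first by rewrite mul1r gap0E.
    by rewrite exprS -mulrA (le_trans (contraction n))// ler_wpM2l.
  apply: le_trans (geo kappa) _; rewrite -ler_pdivlMr//.
  (* Raised to the power [kappa], the lower bound on [delta] becomes
     [(1 - delta) ^+ kappa <= eps / gap0]. *)
  have root_ge : 1 - delta <= (eps / gap0) `^ (1 / kappa%:R) by lra.
  have kR : (kappa%:R : R) != 0 by rewrite pnatr_eq0 -lt0n.
  have rootK : ((eps / gap0) `^ (1 / kappa%:R)) ^+ kappa = eps / gap0.
    rewrite -powR_mulrn ?powR_ge0// -powRrM divfK// powRr1//.
    by rewrite divr_ge0// ltW.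
  by rewrite -rootK lerXn2r ?nnegrE ?powR_ge0.
Qed.
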